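(* Let $n\ge1$ be an integer and $\mathcal P_{n-1}$ the space of complex polynomials of degree at most $n-1$. Let $Q_n$ be the operator $f(x)\mapsto f(-x-n)$ on $\mathcal P_{n-1}$ (i.e. $E^n(1,-x)$, reflection followed by shift by $n$) and $\tilde J_n$ the operator $x^p\mapsto x^{n-1-p}$. Then $$\tilde F_n\,Q_n\,\tilde F_n^{-1}=(-1)^{n-1}\tilde J_n .$$
   Context: $\tilde F_n$ is the linear operator on $\mathcal P_{n-1}$ with $\tilde F_n x^p=(1-x)^{2n+1}\sum_{m\ge1}m^{p+1}\binom{m+n}{n}x^{m-1}$, $p=0,\dots,n-1$ (a polynomial of degree $\le n-1$). It is invertible, with $\tilde F_n^{-1}x^p=\frac{n!}{(2n)!}(x-1)_p[x+n+1]_{n-p-1}$, where $(\varphi)_k=\varphi(\varphi-1)\cdots(\varphi-k+1)$ and $[\varphi]_k=\varphi(\varphi+1)\cdots(\varphi+k-1)$, both $=1$ for $k=0$. *)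

(* Defs.v *)
From HB Require Import structures.
From mathcomp Require Import all_boot all_order all_algebra.
From mathcomp Require Import qpoly.
From mathcomp Require Export complex reals.

Set Implicit Arguments.
Unset Strict Implicit.
Unset Printing Implicit Defensive.

Import GRing.Theory Num.Theory.
Local Open Scope ring_scope.

(* {poly_n K} is the space of polynomials of size at most n, i.e. P_{n-1}. *)

Section Operators.
Variables (K : fieldType) (n : nat).

(* Formal power series are represented by their coefficient sequences, and
   multiplied by the Cauchy product. *)
Definition fps_mul (a b : nat -> K) (k : nat) : K :=
  \sum_(i < k.+1) a i * b (k - i)%N.

(* Coefficients of (1-x)^(2n+1) * sum_{m >= 1} m^(p+1) binom(m+n, n) x^(m-1);
   the second factor is indexed by k = m - 1. *)
Definition Ftilde_series (p : nat) : nat -> K :=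
  fps_mul (fun i => ((1 - 'X : {poly K}) ^+ (2 * n).+1)`_i)
          (fun k => k.+1%:R ^+ p.+1 * 'C(k.+1 + n, n)%:R).

(* mk_npoly keeps the coefficients of index < n only; nothing is lost for
   p < n in characteristic 0, by Ftilde_series_eq0 below. *)
Definition Ftilde_fun (f : {poly_n K}) : {poly_n K} :=
  \sum_(p < n) f`_p *: mk_npoly n (Ftilde_series p).

Fact Qop_subproof (f : {poly_n K}) :
  (f \Po (- 'X - n%:R%:P)) \is a poly_of_size n.
Proof.
have s2 : size (- 'X - n%:R%:P : {poly K}) = 2%N.
  by rewrite -opprD size_polyN size_XaddC.
by rewrite qualifE/= size_comp_poly2 ?size_npoly.
Qed.

Definition Qop_fun (f : {poly_n K}) : {poly_n K} := NPoly (Qop_subproof f).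

Definition Jtilde_fun (f : {poly_n K}) : {poly_n K} :=
  \sum_(p < n) f`_p *: npolyp n 'X^(n - 1 - p).

Fact sum_coef_linear (g : nat -> {poly_n K}) :
  linear (fun f : {poly_n K} => \sum_(p < n) f`_p *: g p).
Proof.
move=> a u v; rewrite scaler_sumr -big_split/=; apply: eq_bigr => p _.
by rewrite coefD coefZ scalerDl scalerA.
Qed.

Fact Ftilde_fun_linear : linear Ftilde_fun.
Proof. exact: (sum_coef_linear (fun p => mk_npoly n (Ftilde_series p))). Qed.

Fact Jtilde_fun_linear : linear Jtilde_fun.
Proof. exact: (sum_coef_linear (fun p => npolyp n 'X^(n - 1 - p))). Qed.

Fact Qop_fun_linear : linear Qop_fun.
Proof.
by move=> a u v; apply/val_inj; rewrite /= comp_polyD comp_polyZ.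
Qed.

HB.instance Definition _ := GRing.isLinear.Build K {poly_n K} {poly_n K} _
  Ftilde_fun Ftilde_fun_linear.
HB.instance Definition _ := GRing.isLinear.Build K {poly_n K} {poly_n K} _
  Jtilde_fun Jtilde_fun_linear.
HB.instance Definition _ := GRing.isLinear.Build K {poly_n K} {poly_n K} _
  Qop_fun Qop_fun_linear.

Definition Ftilde : 'End({poly_n K}) := linfun Ftilde_fun.
Definition Qop : 'End({poly_n K}) := linfun Qop_fun.
Definition Jtilde : 'End({poly_n K}) := linfun Jtilde_fun.

End Operators.

Section WellDefined.
Variable K : numFieldType.

Lemma coef_1BX (N i : nat) :
  ((1 - 'X : {poly K}) ^+ N)`_i = (-1) ^+ i * 'C(N, i)%:R.
Proof.
rewrite exprBn (eq_bigr (fun j : 'I__ => ((-1) ^+ j * 'C(N, j)%:R) *: 'X^j)).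
  rewrite -(poly_def N.+1 (fun j => (-1) ^+ j * 'C(N, j)%:R)) coef_poly;
     case: ltnP => // Ni.
  by rewrite bin_small// mulr0.
move=> j _; rewrite expr1n mulr1 -mul_polyC polyCM polyC_exp polyCN.
by rewrite polyC_natr -mulr_natr mulrAC.
Qed.

Lemma sum_altbin_eq0 (N : nat) (g : {poly K}) (y : K) : (size g <= N)%N ->
  \sum_(j < N.+1) (-1) ^+ j * 'C(N, j)%:R * g.[y - j%:R] = 0.
Proof.
elim: N g => [|N IHN] g sg.
  by move: sg; rewrite leqn0 size_poly_eq0 => /eqP->;
     rewrite big1// => i _; rewrite horner0 mulr0.
pose h := g - (g \Po ('X - 1%:P)).
have sh : (size h <= N)%N.
  have s2 : size ('X - 1%:P : {poly K}) = 2%N by rewrite size_XsubC.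
  have sc : size (g \Po ('X - 1%:P)) = size g by rewrite size_comp_poly2.
  apply/leq_sizeP => i; rewrite leq_eqVlt => /predU1P[<-|Ni]; last first.
    by rewrite coefB !nth_default ?subrr ?sc// (leq_trans sg).
  have [sgN|Nsg] := leqP (size g) N.
    by rewrite coefB !nth_default ?subrr ?sc.
  have eN : N = (size g).-1 by rewrite (anti_leq (introT andP (conj sg Nsg))).
  rewrite coefB; apply/eqP; rewrite subr_eq0 eN -lead_coefE.
  by rewrite -[X in _`_X.-1]sc -lead_coefE lead_coef_comp ?s2// lead_coefXsubC
     expr1n mulr1.
rewrite -[RHS](IHN _ sh).
transitivity (\sum_(j < N.+2) (-1) ^+ j * 'C(N, j)%:R * g.[y - j%:R]
  + \sum_(j < N.+1) (-1) ^+ j.+1 * 'C(N, j)%:R * g.[y - j.+1%:R]).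
  rewrite !(big_ord_recl N.+1) /= !bin0 -addrA; congr (_ + _).
  rewrite -big_split/=; apply: eq_bigr => i _.
  by rewrite /bump/= !add1n binS natrD mulrDr mulrDl.
rewrite big_ord_recr/= bin_small// mulr0 mul0r addr0 -big_split/=.
apply: eq_bigr => i _.
rewrite /h !hornerE horner_comp !hornerE exprS mulN1r !mulNr mulrBr.
by rewrite -(natr1 i) opprD addrA.
Qed.

Lemma Ftilde_series_eq0 (n p k : nat) :
  (p < n)%N -> (n <= k)%N -> Ftilde_series K n p k = 0.
Proof.
move=> pn nk; pose N := (2 * n).+1.
pose g : {poly K} := (n`!%:R)^-1 *: ('X^(p.+1) * \prod_(i < n) ('X + i.+1%:R%:P)).
have sg : (size g <= N)%N.
  apply: leq_trans (size_scale_leq _ _) _.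
  apply: leq_trans (size_polyMleq _ _) _; rewrite size_polyXn /=.
  have : (size (\prod_(i < n) ('X + i.+1%:R%:P) : {poly K})%R <= n.+1)%N.
    rewrite (eq_bigr (fun i : 'I_n => 'X - (- i.+1%:R)%:P)).
      by rewrite size_prod_XsubC /index_enum -enumT size_enum_ord.
    by move=> i _; rewrite polyCN opprK.
  by move=> s; rewrite addSn /= -addSn /N mul2n -addnn -[(n + n).+1]addnS leq_add.
have gN (m : nat) : g.[m%:R] = m%:R ^+ p.+1 * 'C(m + n, n)%:R.
  rewrite hornerZ hornerM hornerXn horner_prod mulrCA; congr (_ * _).
  have n0 : n`!%:R != 0 :> K by rewrite pnatr_eq0 -lt0n fact_gt0.
  apply: (mulfI n0); rewrite mulVKf// -natrM mulnC bin_ffact.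
  elim: (n) => [|q IH]; first by rewrite big_ord0 ffactn0.
  rewrite big_ord_recr/= IH addnS ffactSS mulnC natrM; congr (_ * _).
  by rewrite !hornerE -natrD addnS.
have g0 (m : nat) : (m <= n)%N -> g.[- m%:R] = 0.
  move=> mn; rewrite hornerZ hornerM hornerXn horner_prod.
  case: m mn => [|m] mn; first by rewrite mulr0n oppr0 exprS !mul0r mulr0.
  by rewrite (bigD1 (Ordinal mn))//= hornerD hornerX hornerC addNr mul0r !mulr0.
pose u j : K := (-1) ^+ j * 'C(N, j)%:R * g.[k.+1%:R - j%:R].
have uE (i : nat) : (i <= k)%N ->
    ((1 - 'X : {poly K}) ^+ N)`_i *
    ((k - i).+1%:R ^+ p.+1 * 'C((k - i).+1 + n, n)%:R) = u i.
  by move=> ik; rewrite coef_1BX -gN /u -natrB ?subSn// leqW.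
transitivity (\sum_(i < k.+1) u i).
  by apply: eq_bigr => i _; rewrite -uE// -ltnS.
have widen (a b : nat) : (forall i, (a <= i)%N -> u i = 0) ->
    \sum_(i < a + b) u i = \sum_(i < a) u i.
  move=> ua; rewrite big_split_ord/= [X in _ + X]big1 ?addr0// => i _.
  by rewrite ua// leq_addr.
have uN i : (N < i)%N -> u i = 0.
  by move=> Ni; rewrite /u bin_small// mulr0 mul0r.
have uk i : (k < i)%N -> u i = 0.
  move=> ki; have [iN|/uN//] := leqP i N.
  rewrite /u -opprB -natrB// g0 ?mulr0// leq_subLR.
  by apply: leq_trans iN _; rewrite /N mul2n -addnn -addSn leq_add2r.
rewrite -(widen k.+1 N.+1 uk) addnC (widen N.+1 k.+1 uN).
exact: sum_altbin_eq0.
Qed.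

(* So Ftilde is bijective and Ftilde^-1%VF is its two-sided inverse. *)
Lemma lker_Ftilde (n : nat) : lker (Ftilde K n) == 0%VS.
Proof.
apply/lker0P => f1 f2 /eqP; rewrite -subr_eq0 -linearB => /eqP.
move E : (f1 - f2) => f Ff0.
suff f0 : f = 0 by apply/eqP; rewrite -subr_eq0 E f0.
pose b (k : nat) : K := (f : {poly K}).[k.+1%:R] * (k.+1%:R * 'C(k.+1 + n, n)%:R).
pose a i := ((1 - 'X : {poly K}) ^+ (2 * n).+1)`_i.
have ab0 k : (k < n)%N -> fps_mul a b k = 0.
  move=> kn; have : (Ftilde K n f)`_k = 0 by rewrite Ff0 coef0.
  rewrite lfunE/= /Ftilde_fun coefn_sum.
  move=> <-; rewrite /fps_mul.
  under [RHS]eq_bigr => p _ do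
    rewrite coefZ coef_poly kn /Ftilde_series /fps_mul mulr_sumr.
  rewrite exchange_big/=; apply: eq_bigr => i _.
  rewrite /b (horner_coef_wide _ (size_npoly f)) mulr_suml mulr_sumr.
  apply: eq_bigr => p _; rewrite mulrCA -mulrA.
  congr (_ * _); rewrite mulrCA; congr (_ * _).
  by rewrite exprSr -mulrA.
have b0 k : (k < n)%N -> b k = 0.
  elim/ltn_ind: k => k IH kn.
  have := ab0 k kn; rewrite /fps_mul big_ord_recl subn0 big1 ?addr0.
    by rewrite /a coef_1BX bin0 expr0 !mul1r.
  move=> i _ /=; rewrite IH ?mulr0//.
    by rewrite /bump add1n; rewrite ltn_subrL (leq_trans _ (ltn_ord i)).
  by apply: leq_ltn_trans (leq_subr _ _) kn.
apply/val_inj => /=; apply/eqP; apply: contraT => nf0.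
pose rs := [seq k.+1%:R : K | k <- iota 0 n].
have rsf : all (root f) rs.
  apply/allP => _ /mapP[k + ->]; rewrite mem_iota add0n => /= kn.
  move/eqP: (b0 _ kn); rewrite /b !mulf_eq0 !pnatr_eq0/= => /orP[//|].
  by rewrite -leqn0 leqNgt bin_gt0 leq_addl.
have urs : uniq rs.
  rewrite map_inj_uniq ?iota_uniq// => x y /eqP.
  by rewrite eqr_nat eqSS => /eqP.
have := max_poly_roots nf0 rsf urs.
by rewrite size_map size_iota ltnNge size_npoly.
Qed.

End WellDefined.

(* Main.v *)
(* Put h_f(x) = f(x) x (x+1) ... (x+n) / n!, a polynomial of degree at most 2n.
   The coefficients of F f are those of (1-x)^(2n+1) sum_{m >= 1} h_f(m) x^(m-1).
   Since h_(Q f)(x) = (-1)^(n+1) h_f(-x-n), the reciprocity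
   sum_{m >= 1} h(m) x^m = - sum_{m <= 0} h(m) x^m of rational generating
   functions exchanges the coefficients k and n-1-k; the gap between the two
   ranges is made of the zeros 0, -1, ..., -n of h_f. In terms of coefficients,
   reciprocity says that the (2n+1)-st finite difference of h_f vanishes. *)
Require Import Defs.
From mathcomp Require Import all_boot all_order all_algebra.
From mathcomp Require Import qpoly complex reals.
From mathcomp Require Import zify ring.
Import GRing.Theory.
Local Open Scope ring_scope.

Section Reciprocity.
Variables (K : numFieldType) (n : nat).
Implicit Types (f : {poly K}) (p : {poly_n K}).

Definition weighted f : {poly K} :=
  n`!%:R^-1 *: (f * \prod_(i < n.+1) ('X + i%:R%:P)).

Lemma horner_weighted f x :
  (weighted f).[x] = n`!%:R^-1 * (f.[x] * \prod_(i < n.+1) (x + i%:R)).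
Proof.
rewrite hornerZ hornerM horner_prod; congr (_ * (_ * _)).
by apply: eq_bigr => i _; rewrite hornerD hornerX hornerC.
Qed.

(** The degree is at most (n-1) + (n+1) = 2n, just below the order 2n+1 of the difference in
    [sum_altbin_eq0]. *)
Lemma size_weighted f : (size f <= n)%N -> (size (weighted f) <= (2 * n).+1)%N.
Proof.
move=> sf; apply: leq_trans (size_scale_leq _ _) _.
apply: leq_trans (size_polyMleq _ _) _.
have -> : size (\prod_(i < n.+1) ('X + i%:R%:P) : {poly K})%R = n.+2.
  rewrite (eq_bigr (fun i : 'I_n.+1 => 'X - (- i%:R)%:P)).
    by rewrite size_prod_XsubC /index_enum -enumT size_enum_ord.
  by move=> i _; rewrite polyCN opprK.
by rewrite !addnS /= mul2n -addnn ltnS leq_add2r.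
Qed.

Lemma weighted_nat f (m : nat) :
  (weighted f).[m%:R] = f.[m%:R] * (m%:R * 'C(m + n, n)%:R).
Proof.
have n0 : n`!%:R != 0 :> K by rewrite Num.Theory.pnatr_eq0 -lt0n fact_gt0.
rewrite horner_weighted mulrCA; congr (_ * _); apply: (mulfI n0).
(* The factor i = 0 is m; the others multiply to the falling factorial (m+n)_n = n! binom(m+n,
   n). *)
rewrite mulVKf// mulrCA -natrM mulnC bin_ffact big_ord_recl addr0.
congr (_ * _); elim: (n) => [|q IH]; first by rewrite big_ord0 ffactn0.
by rewrite big_ord_recr/= IH addnS ffactSS mulnC natrM -natrD addnS.
Qed.

Lemma weighted_eq0 f (m : nat) : (m <= n)%N -> (weighted f).[- m%:R] = 0.
Proof.
rewrite -ltnS => mn.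
by rewrite horner_weighted (bigD1 (Ordinal mn))//= addNr mul0r !mulr0.
Qed.

Lemma weighted_refl f x :
  (weighted (f \Po (- 'X - n%:R%:P))).[x]
    = (-1) ^+ n.+1 * (weighted f).[- x - n%:R].
Proof.
rewrite !horner_weighted horner_comp !(hornerD, hornerN, hornerX, hornerC).
rewrite [RHS]mulrCA; congr (_ * _).
rewrite [RHS]mulrCA; congr (_ * _).
(* Reversing the product turns x + (n-i) into -((-x-n) + i): one sign for each of the n+1
   factors. *)
rewrite (reindex_inj rev_ord_inj)/=.
rewrite -[X in _ ^+ X](card_ord n.+1) -prodrN; apply: eq_bigr => i _.
by rewrite subSS natrB ?opprD ?opprK ?addrA// -ltnS.
Qed.

(** Exchanging the two sums collects the powers m^q of each m = k-i+1 into the value of [p] at m;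
    the extra m in m^(q+1) goes into the weight. *)
Lemma coef_Ftilde p (k : nat) : (k < n)%N ->
  (Ftilde K n p)`_k = \sum_(i < k.+1) (-1) ^+ i * 'C((2 * n).+1, i)%:R
                        * (weighted p).[(k - i).+1%:R].
Proof.
move=> kn; rewrite lfunE/= /Ftilde_fun coefn_sum.
under [LHS]eq_bigr => q _ do
  rewrite coefZ coef_poly kn /Ftilde_series /fps_mul mulr_sumr.
rewrite exchange_big/=; apply: eq_bigr => i _.
rewrite weighted_nat (horner_coef_wide _ (size_npoly p)) mulr_suml mulr_sumr.
apply: eq_bigr => q _; rewrite coef_1BX exprSr mulrCA; congr (_ * _).
by rewrite !mulrA.
Qed.

Lemma coef_Jtilde p (k : nat) : (k < n)%N -> (Jtilde K n p)`_k = p`_(n - 1 - k).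
Proof.
move=> kn; have kn' : (n - 1 - k < n)%N by lia.
rewrite lfunE/= /Jtilde_fun coefn_sum (bigD1 (Ordinal kn'))//= big1 => [|q qk].
  have kE : k = (n - 1 - (n - 1 - k))%N by lia.
  by rewrite addr0 coefZ coef_npolyp kn coefXn -kE eqxx mulr1.
rewrite coefZ coef_npolyp kn coefXn; case: eqP => [kq|_]; last by rewrite mulr0.
by case/eqP: qk; apply/val_inj => /=; have := ltn_ord q; lia.
Qed.

(** The vanishing difference runs over the nodes n-k, ..., -n-k-1. Up to sign, the positive nodes
    give the right-hand side and those below -n the left-hand side; the n+1 nodes between are zeros
    of [weighted f]. *)
Lemma weighted_reciprocity f (k : nat) : (size f <= n)%N -> (k < n)%N ->
  \sum_(i < k.+1) (-1) ^+ i * 'C((2 * n).+1, i)%:R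
      * (weighted f).[- (k - i).+1%:R - n%:R]
  = \sum_(i < n - k) (-1) ^+ i * 'C((2 * n).+1, i)%:R
      * (weighted f).[(n - k - i)%:R].
Proof.
move=> sf kn; have := sum_altbin_eq0 (n - k)%:R (size_weighted _ sf).
have eN : (2 * n).+2 = (n - k + (n.+1 + k.+1))%N.
  lia.
rewrite -(big_mkord xpredT (fun j => (-1) ^+ j * 'C((2 * n).+1, j)%:R
  * (weighted f).[(n - k)%:R - j%:R])) eN big_mkord !big_split_ord /=.
rewrite [X in _ + (X + _)]big1 ?add0r; last first.
  move=> i _; rewrite natrD opprD addrA subrr sub0r weighted_eq0 ?mulr0//.
  by rewrite -ltnS.
move/eqP; rewrite addrC addr_eq0 => /eqP E.
apply: oppr_inj; rewrite -sumrN.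
transitivity (\sum_(i < k.+1) (-1) ^+ (n - k + (n.+1 + i))
    * 'C((2 * n).+1, n - k + (n.+1 + i))%:R
    * (weighted f).[(n - k)%:R - (n - k + (n.+1 + i))%:R]).
  (* After reversal the index is 2n+1-i: the binomial is symmetric, and since 2n+1 is odd the sign
     flips. *)
  rewrite [RHS](reindex_inj rev_ord_inj)/=; apply: eq_bigr => i _.
  have ik : (i <= k)%N by rewrite -ltnS.
  have iN : (i <= (2 * n).+1)%N by lia.
  rewrite subSS.
  have -> : (n - k + (n.+1 + (k - i)))%N = ((2 * n).+1 - i)%N by lia.
  have -> : (-1) ^+ ((2 * n).+1 - i) = - (-1) ^+ i :> K.
    rewrite -signr_odd oddB// oddS mul2n odd_double/= -[in RHS]signr_odd.
    by case: (odd i); rewrite ?opprK.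
  rewrite bin_sub// !mulNr; congr (- (_ * _.[_])).
  by rewrite -!natr1 !natrB ?(ltnW kn)// -natr1 natrM; ring.
rewrite E; congr (- _); apply: eq_bigr => i _.
by rewrite [in RHS]natrB// ltnW.
Qed.

Lemma Ftilde_Qop p :
  Ftilde K n (Qop K n p) = (-1) ^+ (n - 1) *: Jtilde K n (Ftilde K n p).
Proof.
apply/val_inj/polyP => k /=.
have [kn|nk] := ltnP k n; last first.
  by rewrite coefZ !big_coef_npoly// mulr0.
have kn' : (n - 1 - k < n)%N by lia.
rewrite coefZ coef_Jtilde// !coef_Ftilde//.
have -> : Qop K n p = p \Po (- 'X - n%:R%:P) :> {poly K} by rewrite lfunE.
under eq_bigr => i _ do rewrite weighted_refl mulrCA.
rewrite -mulr_sumr weighted_reciprocity ?size_npoly//.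
have -> : (n - 1 - k).+1 = (n - k)%N by lia.
(* Since k < n forces n >= 1, [n - 1] is not truncated and has the parity of n+1. *)
have -> : n.+1 = (n - 1).+2 by lia.
rewrite 2!exprS mulN1r mulN1r opprK; congr (_ * _); apply: eq_bigr => i _.
by congr (_ * _.[_%:R]); have := ltn_ord i; lia.
Qed.

End Reciprocity.

Theorem theorem6 (R : realType) (n : nat) (hn : (1 <= n)%N) :
  (Ftilde R[i] n \o Qop R[i] n \o (Ftilde R[i] n)^-1)%VF
    = (-1) ^+ (n - 1) *: Jtilde R[i] n.
Proof.
have -> : (Ftilde R[i] n \o Qop R[i] n)%VF
    = (((-1) ^+ (n - 1) *: Jtilde R[i] n) \o Ftilde R[i] n)%VF.
  by apply/lfunP => p; rewrite !comp_lfunE scale_lfunE Ftilde_Qop.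
(* A trivial kernel makes the endomorphism [Ftilde] invertible, so it cancels on the right. *)
by rewrite -comp_lfunA lker0_compfV ?lker_Ftilde// comp_lfun1r.
Qed.
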